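(* Let $N\ge 3$, let $\beta>0$, and let $F:[0,\infty)\to[0,\infty)$ be a non-decreasing function, not identically zero, such that $F(ts)\leq t^\beta F(s)$ for all $s,t\geq 0$. Then there exists a positive constant $C_{N,F}$, depending only on $N$ and $F$, such that for every $u\in L^2(\mathbb{R}^N)$ with $u\neq 0$ and $$ \int_{\mathbb{R}^{2N}}\frac{F(|u(x)-u(y)|)}{|x-y|^{N+2}}\,dx\,dy<+\infty, $$ one has $$ \int_{\mathbb{R}^N} \frac{u^2}{\|u\|_{2}^2}\log \frac{u^2}{\|u\|_{2}^2} \,dx + \frac{N}{2}\log \|u\|_2^\beta\leq \frac{N}{2} \log \left(C_{N,F} \|u\|_2^\beta +C_{N,F}\int_{\mathbb{R}^{2N}}\frac{F(|u(x)-u(y)|)}{|x-y|^{N+2}}\,dx\,dy\right). $$ In particular, for every $u\in L^2(\mathbb{R}^N)$ satisfying $$ \int_{\mathbb{R}^{2N}}\frac{F(|u(x)-u(y)|)}{|x-y|^{N+2}}\,dx\,dy<+\infty, $$ one has $$ \int_{\mathbb{R}^N} u^2\log u^2 \,dx<+\infty. $$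
   Context: Functions $u$ are real-valued and $\|u\|_2$ denotes the $L^2(\mathbb{R}^N)$ norm with respect to Lebesgue measure. Conventions: $0\log 0=0$; the integrals of $u^2\log u^2$ and of $\frac{u^2}{\|u\|_2^2}\log\frac{u^2}{\|u\|_2^2}$ may take the value $-\infty$. *)

(* Defs.v *)
From HB Require Import structures.
From mathcomp Require Import all_boot all_order all_algebra.
From mathcomp Require Import all_classical all_reals all_analysis.

Set Implicit Arguments.
Unset Strict Implicit.
Unset Printing Implicit Defensive.
Import Order.TTheory GRing.Theory Num.Theory.
Import numFieldNormedType.Exports.
Local Open Scope classical_set_scope.
Local Open Scope ring_scope.

(* R^n is encoded by n-tuples: they carry the product (hence Borel)
   sigma-algebra, whereas ['rV[R]_n] has no measurable structure and is normed
   by the sup norm. *)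
Notation euclidean_space R n := (n.-tuple (measurableTypeR R)).

Section lebesgue_cons.
Context {R : realType} {n : nat}.

Definition tuple_cons (z : measurableTypeR R * euclidean_space R n) :
  euclidean_space R n.+1 := [tuple of z.1 :: z.2].

Lemma measurable_tuple_cons : measurable_fun setT tuple_cons.
Proof. exact: measurable_cons. Qed.

Variable mu : {sigma_finite_measure set (euclidean_space R n) -> \bar R}.

Definition lebesgue_cons : set (euclidean_space R n.+1) -> \bar R :=
  pushforward (lebesgue_measure \x mu)%E tuple_cons.

HB.instance Definition _ := Measure.copy lebesgue_cons
  (measure_function_pushforward__canonical__measure_function_Measure
     (lebesgue_measure \x mu)%E measurable_tuple_cons).

Lemma lebesgue_cons_sigma_finite : sigma_finite setT lebesgue_cons.
Proof.
have /sigma_finiteP[F [UF ndF mF]] :=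
  sigma_finiteT (@lebesgue_measure R : {sigma_finite_measure set _ -> \bar R}).
have /sigma_finiteP[G [UG ndG mG]] := sigma_finiteT mu.
pose g (x : euclidean_space R n.+1) : measurableTypeR R * euclidean_space R n :=
  (thead x, [tuple of behead x]).
have mg : measurable_fun setT g.
  apply/measurable_fun_pairP; split; first exact: measurable_tnth.
  exact: measurable_behead.
have gK : cancel tuple_cons g.
  by case=> a t; rewrite /g theadE; congr pair; exact/val_inj.
exists (fun i => g @^-1` (F i `*` G i)).
  apply/seteqP; split => // x _.
  have [i _ Fi] : (\bigcup_i F i) (g x).1 by rewrite -UF.
  have [j _ Gj] : (\bigcup_i G i) (g x).2 by rewrite -UG.
  exists (maxn i j) => //; split.
    by move: Fi; exact/subsetPset/ndF/leq_maxl.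
  by move: Gj; exact/subsetPset/ndG/leq_maxr.
move=> i; have [[mFi Fioo] [mGi Gioo]] := (mF i, mG i); split.
  by rewrite -[X in measurable X]setTI; apply: mg => //; exact: measurableX.
rewrite /lebesgue_cons /pushforward -comp_preimage.
rewrite (_ : g \o tuple_cons = id) ?preimage_id.
  by rewrite product_measure1E// lte_mul_pinfty// ge0_fin_numE.
by apply/funext => z /=; rewrite gK.
Qed.

HB.instance Definition _ :=
  Measure_isSigmaFinite.Build _ _ _ lebesgue_cons lebesgue_cons_sigma_finite.

End lebesgue_cons.

Fixpoint lebesgue_measure_euclidean (R : realType) (n : nat) :
    {sigma_finite_measure set (euclidean_space R n) -> \bar R} :=
  match n with
  | 0%N => \d_[tuple]
  | n'.+1 => lebesgue_cons (lebesgue_measure_euclidean R n')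
  end.

(* The value on boxes, which characterizes the measure. *)
Lemma lebesgue_measure_euclidean_box (R : realType) (n : nat)
    (A : 'I_n -> set (measurableTypeR R)) :
  (forall i, measurable (A i)) ->
  lebesgue_measure_euclidean R n [set x | forall i, A i (tnth x i)] =
  (\prod_(i < n) lebesgue_measure (A i))%E.
Proof.
elim: n => [|n IH] in A *.
  move=> _; rewrite big_ord0 /= diracE mem_set// => -[].
by move=> [].
move=> mA; rewrite big_ord_recl -IH//=.
pose B := [set t : euclidean_space R n | forall i, A (lift ord0 i) (tnth t i)].
have mB : measurable B.
  rewrite (_ : B =
    \big[setI/setT]_(i < n) ((@tnth _ _ ^~ i) @^-1` A (lift ord0 i))).
    apply: bigsetI_measurable => i _; rewrite -[X in measurable X]setTI.
    exact: measurable_tnth.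
  rewrite -bigcap_seq; apply/seteqP; split => t Bt i.
    by move=> _; exact: Bt.
  by apply: Bt; rewrite /= mem_index_enum.
rewrite -product_measure1E// /lebesgue_cons /pushforward; congr (_ _).
apply/seteqP; split => -[a t] /=.
  move=> At; split => [|i]; first exact: At ord0.
  by have := At (lift ord0 i); rewrite tnthS.
by move=> [Aa Bt] i; case: (unliftP ord0 i) => [j|] ->; rewrite ?tnthS.
Qed.

Definition euclidean_dist (R : realType) (n : nat)
    (x y : euclidean_space R n) : R :=
  Num.sqrt (\sum_(i < n) (tnth x i - tnth y i) ^+ 2).

Definition L2norm (R : realType) (n : nat) (u : euclidean_space R n -> R) : R :=
  fine 'N[lebesgue_measure_euclidean R n]_2%:E[EFin \o u].

(* On the (negligible) diagonal the integrand is a division by 0, hence 0. *)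
Definition nonlocal_energy (R : realType) (n : nat) (F : R -> R)
    (u : euclidean_space R n -> R) : \bar R :=
  (\int[lebesgue_measure_euclidean R n \x lebesgue_measure_euclidean R n]_z
    (F `|u z.1 - u z.2| / euclidean_dist z.1 z.2 ^+ (n + 2))%:E)%E.

(* The library sets [+oo - +oo = -oo], so that [\int[mu]_x f x] is [-oo], rather
   than undefined, when both parts of [f] have an infinite integral. This
   predicate says that the integral is meaningful, with value in [-oo, +oo]. *)
Definition has_integral d (T : measurableType d) (R : realType)
    (mu : {measure set T -> \bar R}) (f : T -> \bar R) : Prop :=
  (\int[mu]_x f^\+ x < +oo \/ \int[mu]_x f^\- x < +oo)%E.

(* Main.v *)
(* Applied with t and 1/t, the hypothesis on F forces F(s) = F(1) s^b for all
   s >= 0, so that beta is determined by F and the energy is a Gagliardo energy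
   of exponent b. Write q = 4/N.

   Whenever u(x) is nonzero, the set where |u| >= |u(x)|/2 has measure at most
   4 ||u||_2^2 / u(x)^2, hence fills at most half of a suitable cube around x.
   On the rest of this cube |u(x) - u(y)| >= |u(x)|/2, and integrating in y, then
   in x, bounds the integral of |u|^(b+q) by a multiple of ||u||_2^q times the
   energy. If b >= 2, then |u|^(2+q) is interpolated between u^2 and |u|^(b+q).
   If b < 2, then going from x to y through their midpoint, with
   (s+t)^b <= K (s^b + t^b) and K < 2, bounds the energy by K/2 times itself; the
   energy thus vanishes, and so does u.

   Finally, for v = u/||u||_2, the inequality ln z <= z/A - 1 + ln A at z = |v|^q
   bounds the entropy of v^2 by (N/2) ln A whenever A dominates the integral of
   |v|^(2+q). *)
Require Import Defs.
From HB Require Import structures.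
From mathcomp Require Import all_boot all_order all_algebra.
From mathcomp Require Import all_classical all_reals all_analysis.
From mathcomp Require Import measurable_realfun.
From mathcomp Require Import ring lra.

Set Implicit Arguments.
Unset Strict Implicit.
Unset Printing Implicit Defensive.
Import Order.TTheory GRing.Theory Num.Theory.
Import numFieldNormedType.Exports.
Local Open Scope classical_set_scope.
Local Open Scope ring_scope.

(** * Change of variables from a point to its midpoint with a fixed point *)

Lemma measurable_half_translate (R : realType) (c : R) :
  measurable_fun setT (fun a : measurableTypeR R => (c + a) / 2 : measurableTypeR R).
Proof. by apply: measurable_funM => //; exact: measurable_funD. Qed.

(** Half of the pushforward gives every half-open interval its length, so it is Lebesgue measure by
    uniqueness. *)
Lemma lebesgue_measure_half_translate (R : realType) (c : R)
    (A : set (measurableTypeR R)) : measurable A ->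
  pushforward lebesgue_measure
    (fun a : measurableTypeR R => (c + a) / 2 : measurableTypeR R) A =
  (2%:E * lebesgue_measure A)%E.
Proof.
move=> mA; pose phi (a : measurableTypeR R) : measurableTypeR R := (c + a) / 2.
have mphi : measurable_fun setT phi := measurable_half_translate c.
pose nu : {measure set (measurableTypeR R) -> \bar R} :=
  measure_function_pushforward__canonical__measure_function_Measure
    lebesgue_measure mphi.
have half_ge0 : 0 <= (2^-1 : R) by [].
suff -> : lebesgue_measure A = mscale (NngNum half_ge0) nu A.
  rewrite -[mscale _ _ _]/((2^-1)%:E * lebesgue_measure (phi @^-1` A))%E.
  by rewrite muleA -EFinM divff// mul1e.
apply: lebesgue_measure_unique => // _ [[a b] _ <-].
rewrite -[RHS]/((2^-1)%:E * lebesgue_measure (phi @^-1` `]a, b]))%E.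
have -> : phi @^-1` `]a, b] = `](2 * a - c), (2 * b - c)]%classic.
  apply/seteqP; split => x /=; rewrite !in_itv /= /phi => /andP[? ?];
    apply/andP; split; lra.
rewrite !lebesgue_measure_itv /= !lte_fin.
have -> : (2 * a - c < 2 * b - c) = (a < b) by apply/idP/idP => ?; lra.
case: ifP => _; last by rewrite mule0.
by rewrite -!EFinD -EFinM; congr EFin; field.
Qed.

Lemma ge0_integral_half_translate (R : realType) (c : R)
    (f : measurableTypeR R -> \bar R) :
  measurable_fun setT f -> (forall a, 0 <= f a)%E ->
  (\int[lebesgue_measure]_a f ((c + a) / 2)%R =
   2%:E * \int[lebesgue_measure]_a f a)%E.
Proof.
move=> mf f0; pose phi (a : measurableTypeR R) : measurableTypeR R := (c + a) / 2.
have mphi : measurable_fun setT phi := measurable_half_translate c.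
rewrite -[LHS]/(\int[lebesgue_measure]_(a in phi @^-1` setT) (f \o phi) a)%E.
rewrite -ge0_integral_pushforward//.
have two_ge0 : 0 <= (2 : R) by [].
rewrite (eq_measure_integral (mscale (NngNum two_ge0) lebesgue_measure)).
  by rewrite ge0_integral_mscale.
move=> A mA _; exact: lebesgue_measure_half_translate.
Qed.

Definition midpoint (R : realType) (n : nat) (x y : euclidean_space R n) :
  euclidean_space R n := [tuple (tnth x i + tnth y i) / 2 | i < n].

Lemma tnth_midpoint (R : realType) (n : nat) (x y : euclidean_space R n)
  (i : 'I_n) : tnth (midpoint x y) i = (tnth x i + tnth y i) / 2.
Proof. by rewrite tnth_mktuple. Qed.

Lemma midpointC (R : realType) (n : nat) : commutative (@midpoint R n).
Proof.
by move=> x y; apply: eq_from_tnth => i; rewrite !tnth_midpoint [tnth y i + _]addrC.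
Qed.

Lemma measurable_midpoint d (T : measurableType d) (R : realType) (n : nat)
    (f g : T -> euclidean_space R n) :
  measurable_fun setT f -> measurable_fun setT g ->
  measurable_fun setT (fun z => midpoint (f z) (g z)).
Proof.
move=> mf mg; apply/measurable_fun_tnthP => i.
rewrite (_ : _ \o _ = fun z => (tnth (f z) i + tnth (g z) i) / 2); last first.
  by apply/funext => z /=; rewrite tnth_midpoint.
apply: measurable_funM => //; apply: measurable_funD.
  exact: (measurableT_comp (measurable_tnth i)).
exact: (measurableT_comp (measurable_tnth i)).
Qed.

(** The measure in dimension [n.+1] is a pushforward of a product by construction, so Tonelli splits
    off the first coordinate. This allows induction on the dimension. *)
Lemma ge0_integral_lebesgue_euclideanS (R : realType) (n : nat)
    (f : euclidean_space R n.+1 -> \bar R) :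
  measurable_fun setT f -> (forall x, 0 <= f x)%E ->
  (\int[lebesgue_measure_euclidean R n.+1]_x f x =
   \int[lebesgue_measure]_a \int[lebesgue_measure_euclidean R n]_t
     f [tuple of a :: t])%E.
Proof.
move=> mf f0.
rewrite -[LHS]/(\int[pushforward (lebesgue_measure \x lebesgue_measure_euclidean R n)
  (@tuple_cons R n)]_x f x)%E.
rewrite (ge0_integral_pushforward (@measurable_tuple_cons R n))//.
rewrite preimage_setT fubini_tonelli1//; last by move=> x; exact: f0.
exact: (measurableT_comp mf (@measurable_tuple_cons R n)).
Qed.

Lemma ge0_integral_midpoint (R : realType) (n : nat) (c : euclidean_space R n)
    (f : euclidean_space R n -> \bar R) :
  measurable_fun setT f -> (forall x, 0 <= f x)%E ->
  (\int[lebesgue_measure_euclidean R n]_x f (midpoint c x) =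
   (2 ^+ n)%:E * \int[lebesgue_measure_euclidean R n]_x f x)%E.
Proof.
elim: n => [|n IH] in c f *.
  move=> mf f0; rewrite expr0 mul1e; apply: eq_integral => x _.
  by rewrite [x]tuple0 [midpoint _ _]tuple0.
move=> mf f0; rewrite ge0_integral_lebesgue_euclideanS//; last first.
  by apply: (measurableT_comp mf); exact: measurable_midpoint.
have mf' : measurable_fun setT (f \o @tuple_cons R n).
  exact: (measurableT_comp mf (@measurable_tuple_cons R n)).
have mG : measurable_fun setT
    (fubini_F (lebesgue_measure_euclidean R n) (f \o @tuple_cons R n)).
  by apply: measurable_fun_fubini_tonelli_F => // x; exact: f0.
pose c' : euclidean_space R n := [tuple of behead c].
(* Head and tail of the midpoint are separate midpoints: the induction hypothesis takes [2 ^+ n] out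
   of the tail, and the head then contributes one more factor 2. *)
under eq_integral => a _.
  under eq_integral => t _.
    rewrite (_ : midpoint c _ = [tuple of ((thead c + a) / 2) :: midpoint c' t]);
      last first.
      apply: eq_from_tnth => i; rewrite tnth_midpoint.
      case: (unliftP ord0 i) => [j|] ->; last by rewrite !tnth0.
      by rewrite !tnthS tnth_midpoint tnth_behead; congr ((tnth _ _ + _) / 2);
        apply/val_inj; rewrite /= inordK// ltnS.
    over.
  rewrite (IH _ (fun t => f [tuple of ((thead c + a) / 2) :: t])); last 2 first.
  - exact: (measurableT_comp mf' (measurable_pair1 _)).
  - by [].
  over.
rewrite ge0_integralZl//=; last 2 first.
- exact: (measurableT_comp mG (measurable_half_translate (thead c))).
- by move=> a _; apply: integral_ge0 => t _; exact: f0.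
rewrite (ge0_integral_half_translate (thead c) mG); last first.
  by move=> a; apply: integral_ge0 => t _; exact: f0.
rewrite ge0_integral_lebesgue_euclideanS// muleA -EFinM -exprSr.
by congr (_ * _)%E.
Qed.

(** * Euclidean distance *)

Lemma euclidean_dist_ge0 (R : realType) (n : nat) (x y : euclidean_space R n) :
  0 <= euclidean_dist x y.
Proof. exact: sqrtr_ge0. Qed.

Lemma euclidean_distC (R : realType) (n : nat) : commutative (@euclidean_dist R n).
Proof.
by move=> x y; congr Num.sqrt; apply: eq_bigr => i _; rewrite -sqrrN opprB.
Qed.

Lemma euclidean_dist_eq0 (R : realType) (n : nat) (x y : euclidean_space R n) :
  (euclidean_dist x y == 0) = (x == y).
Proof.
apply/idP/eqP => [|->]; last first.
  by rewrite /euclidean_dist big1 ?sqrtr0// => i _; rewrite subrr expr0n.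
rewrite sqrtr_eq0 => s0; have {}s0 : \sum_(i < n) (tnth x i - tnth y i) ^+ 2 == 0.
  by rewrite eq_le s0 sumr_ge0// => i _; exact: sqr_ge0.
apply: eq_from_tnth => i; apply/eqP; rewrite -subr_eq0 -sqrf_eq0.
by move: s0; rewrite psumr_eq0 => [/allP/(_ i (mem_index_enum i))|j _] //=;
  exact: sqr_ge0.
Qed.

Lemma euclidean_dist_midpoint (R : realType) (n : nat) (x y : euclidean_space R n) :
  euclidean_dist x y = 2 * euclidean_dist x (midpoint x y).
Proof.
rewrite /euclidean_dist -[2 in RHS](@ger0_norm R 2)// -sqrtr_sqr -sqrtrM ?sqr_ge0//.
rewrite mulr_sumr; congr Num.sqrt; apply: eq_bigr => i _.
by rewrite tnth_midpoint; field.
Qed.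

Lemma measurable_euclidean_dist d (T : measurableType d) (R : realType) (n : nat)
    (f g : T -> euclidean_space R n) :
  measurable_fun setT f -> measurable_fun setT g ->
  measurable_fun setT (fun z => euclidean_dist (f z) (g z)).
Proof.
move=> mf mg; rewrite /euclidean_dist.
have mt (i : 'I_n) (h : T -> euclidean_space R n) : measurable_fun setT h ->
    measurable_fun setT (fun z => tnth (h z) i : R).
  move=> mh; exact: (measurableT_comp (measurable_tnth i)).
have -> : (fun z => Num.sqrt (\sum_(i < n) (tnth (f z) i - tnth (g z) i) ^+ 2)) =
    (@powR R ^~ 2^-1) \o (fun z => \sum_(i < n) (tnth (f z) i - tnth (g z) i) ^+ 2).
  apply/funext => z /=; rewrite powR12_sqrt// sumr_ge0// => i _; exact: sqr_ge0.
apply: measurableT_comp => //; apply: measurable_sum => i.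
by apply: measurable_funX; apply: measurable_funB; exact: mt.
Qed.

(** * The energy density and its behaviour at midpoints *)

Section energy_density.
Context (R : realType) (n : nat) (F : R -> R) (u : euclidean_space R n -> R).
Hypothesis F_ge0 : forall s, 0 <= s -> 0 <= F s.
Hypothesis mF : measurable_fun setT (fun s : R => F `|s|).
Hypothesis meas_u : measurable_fun setT u.

Local Notation mu := (lebesgue_measure_euclidean R n).

Definition energy_density (x y : euclidean_space R n) : R :=
  F `|u x - u y| / euclidean_dist x y ^+ (n + 2).

Lemma energy_density_ge0 x y : 0 <= energy_density x y.
Proof. by rewrite divr_ge0 ?F_ge0// exprn_ge0// euclidean_dist_ge0. Qed.

Lemma energy_densityC x y : energy_density x y = energy_density y x.
Proof. by rewrite /energy_density distrC euclidean_distC. Qed.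

Lemma measurable_energy_density d (T : measurableType d)
    (f g : T -> euclidean_space R n) :
  measurable_fun setT f -> measurable_fun setT g ->
  measurable_fun setT (fun z => (energy_density (f z) (g z))%:E).
Proof.
move=> mf mg; apply/measurable_EFinP; apply: measurable_funM.
  apply: (measurableT_comp mF); apply: measurable_funB; exact: measurableT_comp.
(* Measurability is read off a real power of negative exponent. The identity also holds on the
   diagonal, where both sides are 0. *)
have -> : (fun z => (euclidean_dist (f z) (g z) ^+ (n + 2))^-1) =
    (@powR R ^~ (- (n + 2)%:R)) \o (fun z => euclidean_dist (f z) (g z)).
  by apply/funext => z; rewrite /= powR_invn// euclidean_dist_ge0.
by apply: measurableT_comp => //; exact: measurable_euclidean_dist.
Qed.

Lemma nonlocal_energyE : nonlocal_energy F u =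
  (\int[mu]_x \int[mu]_y (energy_density x y)%:E)%E.
Proof.
rewrite /nonlocal_energy fubini_tonelli1//.
  exact: measurable_energy_density.
by move=> z; rewrite lee_fin energy_density_ge0.
Qed.

Lemma nonlocal_energy_ge0 : (0 <= nonlocal_energy F u)%E.
Proof. by apply: integral_ge0 => z _; rewrite lee_fin energy_density_ge0. Qed.

(** For fixed [x], replacing [midpoint x y] by a new variable costs the factor [2 ^+ n], whatever
    [x] is. *)
Lemma integral_energy_density_midpoint :
  (\int[mu]_x \int[mu]_y (energy_density x (midpoint x y))%:E =
   (2 ^+ n)%:E * nonlocal_energy F u)%E.
Proof.
rewrite nonlocal_energyE -ge0_integralZl//; last 2 first.
- pose f (z : euclidean_space R n * euclidean_space R n) :=
    (energy_density z.1 z.2)%:E.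
  apply: (measurable_fun_fubini_tonelli_F f) => [|z].
    exact: measurable_energy_density.
  by rewrite lee_fin energy_density_ge0.
- by move=> x _; apply: integral_ge0 => y _; rewrite lee_fin energy_density_ge0.
apply: eq_integral => x _.
rewrite (ge0_integral_midpoint x (f := fun y => (energy_density x y)%:E))//.
  exact: measurable_energy_density.
by move=> y; rewrite lee_fin energy_density_ge0.
Qed.

(** The midpoint halves the distance, so both denominators on the right shrink by [2 ^+ (n + 2)],
    which the prefactor compensates. The numerators compare by the triangle inequality, monotonicity
    of [F] and the hypothesis on [K]. *)
Lemma energy_density_le_midpoint (K : R) :
  (forall s t, 0 <= s -> 0 <= t -> F (s + t) <= K * (F s + F t)) ->
  (forall s t, 0 <= s -> s <= t -> F s <= F t) ->
  forall x y, energy_density x y <=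
    K / 2 ^+ (n + 2) * (energy_density x (midpoint x y) +
                        energy_density (midpoint x y) y).
Proof.
move=> FK F_nd x y; set m := midpoint x y.
rewrite /energy_density [in leRHS](euclidean_distC m y).
rewrite -[m in euclidean_dist y m]midpointC.
have := euclidean_dist_midpoint y x; rewrite euclidean_distC => dy.
have dx := euclidean_dist_midpoint x y.
have -> : euclidean_dist x m = euclidean_dist x y / 2 by rewrite dx; field.
have -> : euclidean_dist y (midpoint y x) = euclidean_dist x y / 2.
  by rewrite dy; field.
rewrite -mulrDl expr_div_n invfM invrK.
(* Since [D] names the inverse itself, the identity below only needs [P] to be non-zero and covers
   [x = y] as well. *)
set P : R := 2 ^+ (n + 2); set D := (euclidean_dist x y ^+ (n + 2))^-1.
have P0 : P != 0 by rewrite expf_neq0.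
have -> : K / P * ((F `|u x - u m| + F `|u m - u y|) * (D * P)) =
    K * (F `|u x - u m| + F `|u m - u y|) * D by field.
have D0 : 0 <= D by rewrite invr_ge0 exprn_ge0// euclidean_dist_ge0.
rewrite ler_wpM2r//; apply: le_trans (FK _ _ (normr_ge0 _) (normr_ge0 _)).
by apply: F_nd => //; rewrite (le_trans _ (ler_normD _ _))// addrA subrK.
Qed.

(** Both terms of the midpoint bound integrate to [2 ^+ n] times the energy, so the total factor is
    [2 * 2 ^+ n * K / 2 ^+ (n + 2) = K / 2 < 1]. A finite energy bounded by [K / 2] times itself
    vanishes. *)
Lemma nonlocal_energy_eq0 (K : R) : 0 <= K < 2 ->
  (forall s t, 0 <= s -> 0 <= t -> F (s + t) <= K * (F s + F t)) ->
  (forall s t, 0 <= s -> s <= t -> F s <= F t) ->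
  (nonlocal_energy F u < +oo)%E -> nonlocal_energy F u = 0%E.
Proof.
move=> /andP[K0 K2] FK F_nd Eoo.
set E := nonlocal_energy F u.
have E_ge0 : (0 <= E)%E := nonlocal_energy_ge0.
have Efin : E \is a fin_num by rewrite ge0_fin_numE.
suff : (E <= (K / 2)%:E * E)%E.
  move: Efin => /fineK <-; rewrite -EFinM lee_fin => h.
  congr EFin; apply/eqP; rewrite eq_le fine_ge0// andbT.
  by have := fine_ge0 E_ge0; nra.
have mm : measurable_fun setT (fun z : euclidean_space R n * euclidean_space R n =>
    midpoint z.1 z.2) by exact: measurable_midpoint.
pose f (z : euclidean_space R n * euclidean_space R n) :=
  (energy_density z.1 (midpoint z.1 z.2))%:E.
pose g (z : euclidean_space R n * euclidean_space R n) :=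
  (energy_density (midpoint z.1 z.2) z.2)%:E.
have mf : measurable_fun setT f by exact: measurable_energy_density.
have mg : measurable_fun setT g by exact: measurable_energy_density.
have f0 z : (0 <= f z)%E by rewrite lee_fin energy_density_ge0.
have g0 z : (0 <= g z)%E by rewrite lee_fin energy_density_ge0.
have If : (\int[mu \x mu]_z f z = (2 ^+ n)%:E * E)%E.
  by rewrite fubini_tonelli1// integral_energy_density_midpoint.
have Ig : (\int[mu \x mu]_z g z = (2 ^+ n)%:E * E)%E.
  (* Integrating in the other order and using the symmetry of the density and of the midpoint turns
     this integral into the previous one. *)
  rewrite fubini_tonelli2// -integral_energy_density_midpoint.
  apply: eq_integral => y _; apply: eq_integral => x _.
  by rewrite /g /= energy_densityC midpointC.
apply: (@le_trans _ _
    (\int[mu \x mu]_z ((K / 2 ^+ (n + 2))%:E * (f z + g z)))%E).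
  apply: ge0_le_integral => //.
  - by move=> z _; rewrite lee_fin energy_density_ge0.
  - exact: measurable_energy_density.
  - by apply: measurable_funeM; exact: emeasurable_funD.
  - move=> z _; rewrite /f /g -EFinD -EFinM lee_fin.
    exact: energy_density_le_midpoint.
rewrite ge0_integralZl_EFin//; last 3 first.
- by move=> z _; exact: adde_ge0.
- exact: emeasurable_funD.
- by rewrite divr_ge0.
rewrite ge0_integralD// If Ig -(fineK Efin) -!EFinM lee_fin.
rewrite le_eqVlt; apply/orP; left; rewrite exprD; apply/eqP; field.
by rewrite expf_neq0.
Qed.

End energy_density.

(** * Cubes, Chebyshev's inequality and the estimate at the level of one point *)

Definition cube (R : realType) (n : nat) (x : euclidean_space R n) (r : R) :
    set (euclidean_space R n) :=
  [set y | forall i, `]tnth x i - r / 2, tnth x i + r / 2]%classic (tnth y i)].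

Lemma lebesgue_measure_cube (R : realType) (n : nat) (x : euclidean_space R n)
    (r : R) : 0 < r ->
  lebesgue_measure_euclidean R n (cube x r) = (r ^+ n)%:E.
Proof.
move=> r0; rewrite /cube (lebesgue_measure_euclidean_box
  (A := fun i => `]tnth x i - r / 2, tnth x i + r / 2]%classic)); last first.
  by move=> i; exact: measurable_itv.
rewrite (eq_bigr (fun=> r%:E)) => [|i _].
  by rewrite prodEFin prodr_const card_ord.
rewrite lebesgue_measure_itv /= lte_fin ifT; last by lra.
by rewrite -EFinD; congr EFin; field.
Qed.

Lemma measurable_cube (R : realType) (n : nat) (x : euclidean_space R n) (r : R) :
  measurable (cube x r).
Proof.
have -> : cube x r = \bigcap_(i in [set: 'I_n])
    ((@tnth n (measurableTypeR R) ^~ i) @^-1`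
      `]tnth x i - r / 2, tnth x i + r / 2]%classic).
  by apply/seteqP; split => [y xy i _|y xy i]; [exact: xy|exact: (xy i)].
apply: fin_bigcap_measurable => [|i _]; first exact: finite_finset.
by rewrite -[X in measurable X]setTI; apply: measurable_tnth => //;
  exact: measurable_itv.
Qed.

Lemma euclidean_dist_cube (R : realType) (n : nat) (x y : euclidean_space R n)
    (r : R) : 0 <= r -> cube x r y ->
  euclidean_dist x y <= Num.sqrt n%:R * r.
Proof.
move=> r0 xy; rewrite -[r in leRHS]ger0_norm// -sqrtr_sqr -sqrtrM// ler_wsqrtr//.
rewrite (@le_trans _ _ (\sum_(i < n) r ^+ 2))//; last first.
  by rewrite sumr_const card_ord mulr_natl.
apply: ler_sum => i _; have := xy i; rewrite /= in_itv /= => /andP[? ?].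
nra.
Qed.

Lemma chebyshev_L2 d (T : measurableType d) (R : realType)
    (mu : {measure set T -> \bar R}) (u : T -> R) (t m : R) :
  measurable_fun setT u -> 0 < t -> (\int[mu]_x (u x ^+ 2)%:E <= m%:E)%E ->
  (mu [set x | (t <= `|u x|)%R] <= (m / t ^+ 2)%:E)%E.
Proof.
move=> meas_u t0 um; set A := [set x | _].
have mA : measurable A.
  rewrite -[A]setTI.
  apply: (@measurable_fun_le _ _ _ setT (cst t) (fun x => `|u x|)) => //.
  exact: measurableT_comp.
rewrite EFinM lee_pdivlMr ?exprn_gt0// muleC.
apply: le_trans um; rewrite -integral_cst//.
have mu2 : measurable_fun setT (fun x => (u x ^+ 2)%:E).
  by apply/measurable_EFinP; exact: measurable_funX.
apply: (@le_trans _ _ (\int[mu]_(x in A) (u x ^+ 2)%:E)%E).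
  apply: ge0_le_integral => //.
  - by move=> x _; rewrite lee_fin sqr_ge0.
  - exact: measurable_funTS.
  - move=> x Ax; rewrite lee_fin -(real_normK (num_real (u x))).
    by rewrite lerXn2r ?nnegrE// ltW.
by apply: ge0_subset_integral => // x _; rewrite lee_fin sqr_ge0.
Qed.

(** The purely dimensional part of [S ^+ (n + 2) / L], where [S = Num.sqrt n%:R * r] bounds the
    distances in a cube of volume [r ^+ n = 2 * L]: the factor 2 comes from [r ^+ n], the last power
    from [r ^+ 2]. *)
Definition level_constant (R : realType) (n : nat) : R :=
  2 * Num.sqrt n%:R ^+ (n + 2) * 2 `^ (2 / n%:R).

Lemma level_constant_gt0 (R : realType) (n : nat) : (0 < n)%N ->
  0 < level_constant R n.
Proof.
by move=> n0; rewrite !mulr_gt0 ?powR_gt0 ?exprn_gt0// sqrtr_gt0 ltr0n.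
Qed.

Section level_estimate.
Context (R : realType) (n : nat) (F : R -> R) (u : euclidean_space R n -> R).
Hypothesis n_gt0 : (0 < n)%N.
Hypothesis F_ge0 : forall s, 0 <= s -> 0 <= F s.
Hypothesis F_nd : forall s t, 0 <= s -> s <= t -> F s <= F t.
Hypothesis mF : measurable_fun setT (fun s : R => F `|s|).
Hypothesis meas_u : measurable_fun setT u.
Variable m : R.
Hypothesis m_gt0 : 0 < m.

Local Notation mu := (lebesgue_measure_euclidean R n).

Hypothesis u_le : (\int[mu]_x (u x ^+ 2)%:E <= m%:E)%E.

(* The set where [|u| >= |u x| / 2] has measure at most [L], hence fills at most
   half of the cube of volume [2 L] centred at [x]; on the other half,
   [|u x - u y| >= |u x| / 2]. *)
Lemma level_le_integral_energy_density x :
  ((F (`|u x| / 2) * (`|u x| / 2) `^ (4 / n%:R))%:E <=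
   (level_constant R n * m `^ (2 / n%:R))%:E *
   \int[mu]_y (energy_density F u x y)%:E)%E.
Proof.
have nR0 : n%:R != 0 :> R by rewrite pnatr_eq0 -lt0n.
(* Chebyshev's inequality needs a positive level. Where [u] vanishes, the left side is 0 because its
   exponent [4 / n] is non-zero. *)
have [ux0|ux0] := eqVneq (u x) 0.
  rewrite ux0 normr0 mul0r powR0 ?mulf_neq0 ?invr_eq0// mulr0.
  apply: mule_ge0.
    by rewrite lee_fin mulr_ge0 ?powR_ge0 ?ltW ?level_constant_gt0.
  by apply: integral_ge0 => y _; rewrite lee_fin energy_density_ge0.
set t := `|u x| / 2; have t0 : 0 < t by rewrite divr_gt0// normr_gt0.
(* [L] is the Chebyshev bound at level [t], and the side [r] is then chosen to give the cube volume
   [2 * L]. *)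
pose L := m / t ^+ 2; have L0 : 0 < L by rewrite divr_gt0// exprn_gt0.
pose r := (2 * L) `^ n%:R^-1; have r0 : 0 < r by rewrite powR_gt0// mulr_gt0.
have rn : r ^+ n = 2 * L.
  by rewrite -powR_mulrn ?ltW// -powRrM mulVf// powRr1// ltW// mulr_gt0.
set A := [set y | t <= `|u y|].
have mA : measurable A.
  rewrite -[A]setTI.
  apply: (@measurable_fun_le _ _ _ setT (cst t) (fun x => `|u x|)) => //.
  exact: measurableT_comp.
have muA : (mu A <= L%:E)%E by exact: chebyshev_L2.
pose D := cube x r `\` A.
have mQ := measurable_cube x r.
have mD : measurable D by exact: measurableD.
have muD : (L%:E <= mu D)%E.
  have : (mu (cube x r) <= mu D + mu A)%E.
    apply: le_trans (measureU2 _ mD mA); apply: le_measure; rewrite ?inE//.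
      exact: measurableU.
    by move=> y Qy; have [Ay|nAy] := pselect (A y); [right|left].
  rewrite lebesgue_measure_cube// rn => h.
  have {}h : ((2 * L)%:E <= mu D + L%:E)%E by exact: le_trans h (leeD2l _ muA).
  by move: h; rewrite -leeBlDr// -EFinB; apply: le_trans; rewrite lee_fin; lra.
set S := Num.sqrt n%:R * r.
have S0 : 0 < S by rewrite mulr_gt0// sqrtr_gt0 ltr0n.
have mk : measurable_fun setT (fun y => (energy_density F u x y)%:E).
  exact: measurable_energy_density.
(* On [D] the distance to [x] is at most [S] and the increment of [u] is at least [t], so the
   density is at least the constant [F t / S ^+ (n + 2)]. *)
have lower : ((F t / S ^+ (n + 2) * L)%:E <=
    \int[mu]_y (energy_density F u x y)%:E)%E.
  have c0 : 0 <= F t / S ^+ (n + 2).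
    by rewrite divr_ge0 ?exprn_ge0 ?F_ge0// ltW.
  apply: (@le_trans _ _ ((F t / S ^+ (n + 2))%:E * mu D)%E).
    by rewrite EFinM lee_wpmul2l.
  rewrite -integral_cst//.
  apply: (@le_trans _ _ (\int[mu]_(y in D) (energy_density F u x y)%:E)%E).
    apply: ge0_le_integral => //; first exact: measurable_funTS.
    move=> y [Qy nAy]; rewrite lee_fin.
    have tuy : `|u y| < t by rewrite ltNge; apply/negP.
    have tF : t <= `|u x - u y|.
      have := ler_normD (u x - u y) (u y); rewrite subrK.
      have : `|u x| = 2 * t by rewrite /t; field.
      lra.
    (* Inverting the bound on the distance requires [x] and [y] to differ, and they do since [u]
       changes by at least [t > 0] between them. *)
    have d0 : 0 < euclidean_dist x y.
      rewrite lt_neqAle euclidean_dist_ge0 andbT eq_sym euclidean_dist_eq0.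
      apply/eqP => xy; move: tF; rewrite xy subrr normr0; lra.
    apply: ler_pM; rewrite ?invr_ge0 ?exprn_ge0 ?(ltW S0)//.
    - exact: F_ge0 (ltW t0).
    - exact: F_nd (ltW t0) tF.
    - rewrite lef_pV2 ?posrE ?exprn_gt0// lerXn2r ?nnegrE ?(ltW S0) ?(ltW d0)//.
      exact: euclidean_dist_cube (ltW r0) Qy.
  by apply: ge0_subset_integral => // y _; rewrite lee_fin energy_density_ge0.
have kappa0 : 0 <= level_constant R n * m `^ (2 / n%:R).
  by rewrite mulr_ge0 ?powR_ge0// ltW// level_constant_gt0.
apply: le_trans (lee_wpmul2l _ lower); last by rewrite lee_fin.
rewrite -EFinM lee_fin le_eqVlt; apply/orP; left; apply/eqP.
have r2 : r ^+ 2 = 2 `^ (2 / n%:R) * m `^ (2 / n%:R) / t `^ (4 / n%:R).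
  rewrite /r -powR_mulrn ?powR_ge0// -powRrM [_^-1 * _]mulrC.
  rewrite powRM ?(ltW L0)// powRM ?invr_ge0 ?exprn_ge0 ?ltW// -mulrA.
  congr (_ * (_ * _)); rewrite -powR_invn ?ltW// -powRrM -powRN.
  by congr (_ `^ _); field.
rewrite /level_constant /S exprMn [r ^+ (n + 2)]exprD rn r2.
have s0 : Num.sqrt n%:R ^+ (n + 2) != 0 :> R.
  by rewrite expf_neq0// sqrtr_eq0 -ltNge ltr0n.
have p1 : 2 `^ (2 / n%:R) != 0 :> R by rewrite powR_eq0 negb_and pnatr_eq0.
have p2 : m `^ (2 / n%:R) != 0 by rewrite powR_eq0 negb_and gt_eqF.
have p3 : t `^ (4 / n%:R) != 0 by rewrite powR_eq0 negb_and gt_eqF.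
have L1 : L != 0 by rewrite gt_eqF.
field.
by rewrite s0 p1 p2 p3 L1.
Qed.

Lemma integral_level_le_energy :
  (\int[mu]_x (F (`|u x| / 2) * (`|u x| / 2) `^ (4 / n%:R))%:E <=
   (level_constant R n * m `^ (2 / n%:R))%:E * nonlocal_energy F u)%E.
Proof.
pose f (z : euclidean_space R n * euclidean_space R n) :=
  (energy_density F u z.1 z.2)%:E.
have mf : measurable_fun setT f by exact: measurable_energy_density.
have f0 z : (0 <= f z)%E by rewrite lee_fin energy_density_ge0.
rewrite nonlocal_energyE// -ge0_integralZl_EFin//; last 3 first.
- by move=> x _; apply: integral_ge0 => y _; rewrite lee_fin energy_density_ge0.
- exact: (measurable_fun_fubini_tonelli_F f).
- by rewrite mulr_ge0 ?powR_ge0// ltW// level_constant_gt0.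
apply: ge0_le_integral => //.
- by move=> x _; rewrite lee_fin mulr_ge0 ?powR_ge0// F_ge0.
- have mu2 : measurable_fun setT (fun x => `|u x| / 2).
    by apply: measurable_funM => //; exact: measurableT_comp.
  apply/measurable_EFinP; apply: measurable_funM.
    rewrite (_ : (fun x => F _) = (fun s : R => F `|s|) \o (fun x => `|u x| / 2)).
      exact: measurableT_comp.
    by apply/funext => x /=; rewrite [ `|_ / _|]ger0_norm// divr_ge0.
  exact: (measurableT_comp (measurable_powR _) mu2).
- by apply: measurable_funeM; exact: (measurable_fun_fubini_tonelli_F f).
- by move=> x _; exact: level_le_integral_energy_density.
Qed.

End level_estimate.

(** * Near-subadditivity of powers with exponent below 2 *)

Lemma powRD_le (R : realType) (b : R) : 0 < b < 2 ->
  exists2 K : R, 0 <= K < 2 &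
    forall s t : R, 0 <= s -> 0 <= t -> (s + t) `^ b <= K * (s `^ b + t `^ b).
Proof.
move=> /andP[b0 b2]; have [b1|b1] := leP b 1.
  exists 1; first by lra.
  move=> s t s0 t0; rewrite mul1r.
  have [st|st] := eqVneq (s + t) 0.
    by rewrite st powR0 ?gt_eqF// addr_ge0 ?powR_ge0.
  have st0 : 0 < s + t by rewrite lt_neqAle eq_sym st addr_ge0.
  have H x : 0 <= x -> x <= s + t -> x / (s + t) * (s + t) `^ b <= x `^ b.
    move=> x0 xst; rewrite -[x in leRHS](divfK st) powRM ?divr_ge0 ?(ltW st0)//.
    rewrite ler_wpM2r ?powR_ge0//; have [->|xN0] := eqVneq x 0.
      by rewrite mul0r powR_ge0.
    apply: ger1_powR => //; rewrite divr_gt0//= ?ler_pdivrMr ?mul1r//.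
    by rewrite lt_neqAle eq_sym xN0.
  apply: le_trans (lerD (H s s0 _) (H t t0 _)); [|lra|lra].
  by rewrite -!mulrDl divff// mul1r.
(* For [1 < b < 2], convexity at the midpoint of [s] and [t] yields this constant, which is below 2
   because [b - 1 < 1]. *)
exists (2 `^ (b - 1)).
  rewrite powR_ge0/= -[b - 1](subrK 1) powRD ?pnatr_eq0 ?implybT// powRr1//.
  rewrite gtr_pMl// -[_ - 1]opprB powRN invf_lt1 ?powR_gt0//.
  rewrite -[ltLHS](congr1 (fun f => f (1 - (b - 1))) (powR1 R)).
  by apply: gt0_ltr_powR; rewrite ?nnegrE ?ltr1n//; lra.
move=> s t s0 t0.
have half_ge0 : 0 <= 2^-1 :> R by rewrite invr_ge0.
have half_le1 : 2^-1 <= 1 :> R by lra.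
have := @convex_powR R b (ltW b1) (Itv01 half_ge0 half_le1) s t.
rewrite !inE /= !in_itv /= s0 t0 => /(_ isT isT).
move=> h; have {}h : (2^-1 * s + (1 - 2^-1) * t) `^ b <=
  2^-1 * s `^ b + (1 - 2^-1) * t `^ b := h.
have {}h : ((s + t) / 2) `^ b <= (s `^ b + t `^ b) / 2.
  have e x y : 2^-1 * x + (1 - 2^-1) * y = (x + y) / 2 :> R by field.
  by rewrite -!e.
rewrite (_ : s + t = (s + t) / 2 * 2); last by field.
rewrite powRM ?divr_ge0 ?addr_ge0//.
apply: le_trans (ler_wpM2r (powR_ge0 _ _) h) _.
rewrite le_eqVlt; apply/orP; left; apply/eqP.
have -> : 2 `^ b = 2 * 2 `^ (b - 1) :> R by rewrite mulr_powRB1.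
by field.
Qed.

(** * Homogeneous functions are powers of a unique degree *)

Section homogeneous.
Context (R : realType) (F : R -> R).
Hypothesis F_ge0 : forall s, 0 <= s -> 0 <= F s.

Lemma homogeneous_eq_powR (b : R) : 0 < b ->
  (forall s t, 0 <= s -> 0 <= t -> F (t * s) <= t `^ b * F s) ->
  forall s, 0 <= s -> F s = F 1 * s `^ b.
Proof.
move=> b0 Fb s; rewrite le_eqVlt => /predU1P[<-|s0].
  (* At [s = 0] there is no inverse to scale by; scaling 1 by 0 gives [F 0 <= 0] instead. *)
  rewrite powR0 ?gt_eqF// mulr0; apply/eqP; rewrite eq_le F_ge0// andbT.
  by have := Fb 1 0 ler01 (lexx _); rewrite mul0r powR0 ?gt_eqF// mul0r.
apply/eqP; rewrite eq_le; apply/andP; split.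
  by have := Fb 1 s ler01 (ltW s0); rewrite mulr1 mulrC.
have := Fb s s^-1 (ltW s0); rewrite invr_ge0 mulVf ?gt_eqF// => /(_ (ltW s0)).
rewrite -powR_inv1 ?(ltW s0)// -powRrM mulN1r powRN mulrC.
by rewrite ler_pdivlMr ?powR_gt0.
Qed.

Hypothesis F_neq0 : exists2 s, 0 <= s & F s != 0.

Lemma homogeneous_gt0 (b : R) : 0 < b ->
  (forall s t, 0 <= s -> 0 <= t -> F (t * s) <= t `^ b * F s) -> 0 < F 1.
Proof.
move=> b0 Fb; have [s s0 Fs] := F_neq0.
rewrite lt_neqAle F_ge0// andbT eq_sym; apply: contra_neq Fs => F1.
by rewrite (homogeneous_eq_powR b0 Fb)// F1 mul0r.
Qed.

(** Both power formulas are compared at 2 through logarithms. Uniqueness lets the constant of the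
    theorem depend on [F] but not on the exponent. *)
Lemma homogeneous_degree_unique (b c : R) : 0 < b -> 0 < c ->
  (forall s t, 0 <= s -> 0 <= t -> F (t * s) <= t `^ b * F s) ->
  (forall s t, 0 <= s -> 0 <= t -> F (t * s) <= t `^ c * F s) -> b = c.
Proof.
move=> b0 c0 Fb Fc; have F1 := homogeneous_gt0 b0 Fb.
have := homogeneous_eq_powR b0 Fb (ler0n R 2).
rewrite (homogeneous_eq_powR c0 Fc)// => /(mulfI (lt0r_neq0 F1))/(congr1 (@ln R)).
rewrite !ln_powR => /mulIf -> //; rewrite lt0r_neq0//; apply: ln_gt0; exact: ltr1n.
Qed.

End homogeneous.

(** * The logarithmic inequality and its integration to an entropy bound *)

Lemma ln_le_div (R : realType) (z A : R) : 0 < z -> 0 < A ->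
  ln z <= z / A - 1 + ln A.
Proof.
move=> z0 A0; rewrite -lerBlDr -ln_div ?posrE//.
(* This is [ln (1 + x) <= x] at [x = z / A - 1]. *)
rewrite -[X in ln X](subrKC 1) le_ln1Dx// ltrBrDr addrC subrr.
by rewrite divr_gt0.
Qed.

(* Apply [ln z <= z / A - 1 + ln A] to [z = |v| ^ q]. *)
Lemma sqr_ln_sqr_le (R : realType) (q A v : R) : 0 < q -> 0 < A ->
  v ^+ 2 * ln (v ^+ 2) <=
  2 / q * (`|v| `^ (2 + q) / A + (ln A - 1) * v ^+ 2).
Proof.
move=> q0 A0; have [->|v0] := eqVneq v 0.
  have q2 : 2 + q != 0 by rewrite gt_eqF// addr_gt0.
  by rewrite normr0 powR0// expr0n/= !(mul0r, mulr0, addr0).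
have w0 : 0 < `|v| by rewrite normr_gt0.
rewrite -(real_normK (num_real v)) lnXn// powRD ?(gt_eqF w0) ?implybT//.
rewrite powR_mulrn ?(ltW w0)//; set w := `|v| in w0 *.
have := ln_le_div (powR_gt0 q w0) A0; rewrite ln_powR => h.
have -> : w ^+ 2 * (ln w *+ 2) = 2 / q * (w ^+ 2 * (q * ln w)).
  by rewrite -mulr_natr; field; rewrite gt_eqF.
rewrite ler_pM2l ?divr_gt0//.
apply: le_trans (ler_wpM2l (sqr_ge0 w) h) _.
by rewrite le_eqVlt; apply/orP; left; apply/eqP; field; rewrite gt_eqF.
Qed.

Section le_integrable_has_integral.
Local Open Scope ereal_scope.
Context d (T : measurableType d) (R : realType) (mu : {measure set T -> \bar R}).

(** The majorant controls the positive part of [f], which makes the integral meaningful. The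
    negative part may have infinite integral, so the two parts are compared separately. *)
Lemma has_integral_le_integrable (f g : T -> \bar R) :
  measurable_fun setT f -> mu.-integrable setT g -> (forall x, f x <= g x) ->
  has_integral mu f /\ \int[mu]_x f x <= \int[mu]_x g x.
Proof.
move=> mf gi fg; have mg := measurable_int _ gi.
have fpgp : \int[mu]_x f^\+ x <= \int[mu]_x g^\+ x.
  apply: ge0_le_integral => //; [exact: measurable_funepos..|].
  by move=> x _; apply: funepos_le (mem_set _) => //.
have gnfn : \int[mu]_x g^\- x <= \int[mu]_x f^\- x.
  apply: ge0_le_integral => //; [exact: measurable_funeneg..|].
  by move=> x _; apply: funeneg_le (mem_set _) => //.
split; last by rewrite integralE [leRHS]integralE leeB.
by left; apply: le_lt_trans fpgp _; exact: integral_funepos_lt_pinfty.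
Qed.

End le_integrable_has_integral.

Section entropy.
Context d (T : measurableType d) (R : realType) (mu : {measure set T -> \bar R}).
Variables (v : T -> R) (q : R).
Hypotheses (mv : measurable_fun setT v) (q_gt0 : 0 < q).

Let mvsq : measurable_fun setT (fun x => (v x ^+ 2)%:E).
Proof. by apply/measurable_EFinP; exact: measurable_funX. Qed.

Let mvp : measurable_fun setT (fun x => (`|v x| `^ (2 + q))%:E).
Proof.
apply/measurable_EFinP; apply: (measurableT_comp (measurable_powR (2 + q))).
exact: measurableT_comp.
Qed.

Lemma measurable_sqr_ln_sqr :
  measurable_fun setT (fun x => (v x ^+ 2 * ln (v x ^+ 2))%:E).
Proof.
have mv2 : measurable_fun setT (fun x => v x ^+ 2) by exact: measurable_funX.
apply/measurable_EFinP; apply: measurable_funM => //.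
exact: (measurableT_comp (@measurable_ln R)).
Qed.

Lemma integrable_sqr_ln_bound (A : R) :
  mu.-integrable setT (fun x => (v x ^+ 2)%:E) ->
  mu.-integrable setT (fun x => (`|v x| `^ (2 + q))%:E) ->
  mu.-integrable setT (fun x =>
    (2 / q * (`|v x| `^ (2 + q) / A + (ln A - 1) * v x ^+ 2))%:E) /\
  (\int[mu]_x (2 / q * (`|v x| `^ (2 + q) / A + (ln A - 1) * v x ^+ 2))%:E =
   (2 / (q * A))%:E * \int[mu]_x (`|v x| `^ (2 + q))%:E +
   (2 / q * (ln A - 1))%:E * \int[mu]_x (v x ^+ 2)%:E)%E.
Proof.
move=> i2 ip.
have -> : (fun x => (2 / q * (`|v x| `^ (2 + q) / A + (ln A - 1) * v x ^+ 2))%:E) =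
    (fun x => (2 / (q * A))%:E * (`|v x| `^ (2 + q))%:E +
              (2 / q * (ln A - 1))%:E * (v x ^+ 2)%:E)%E.
  apply/funext => x; rewrite -!EFinM -EFinD; congr EFin.
  by rewrite invfM; ring.
split; first by apply: integrableD => //; exact: integrableZl.
by rewrite integralD//; [rewrite !integralZl|exact: integrableZl..].
Qed.

Lemma entropy_lt_pinfty :
  mu.-integrable setT (fun x => (v x ^+ 2)%:E) ->
  mu.-integrable setT (fun x => (`|v x| `^ (2 + q))%:E) ->
  has_integral mu (fun x => (v x ^+ 2 * ln (v x ^+ 2))%:E) /\
  (\int[mu]_x (v x ^+ 2 * ln (v x ^+ 2))%:E < +oo)%E.
Proof.
(* Only finiteness is at stake, so the majorant is taken at [A = 1], where [ln A = 0]. *)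
move=> i2 ip; have [ig _] := integrable_sqr_ln_bound 1 i2 ip.
have [|? le] := has_integral_le_integrable measurable_sqr_ln_sqr ig.
  by move=> x; rewrite lee_fin sqr_ln_sqr_le.
by split=> //; apply: le_lt_trans le _; exact: integrable_lty.
Qed.

(** With unit mass and the [2 + q] moment at most [A], the integrated majorant is at most
    [2 / q * (A / A + ln A - 1)], in which the constants cancel. *)
Lemma entropy_le_ln (A : R) : 0 < A ->
  (\int[mu]_x (v x ^+ 2)%:E = 1)%E ->
  (\int[mu]_x (`|v x| `^ (2 + q))%:E <= A%:E)%E ->
  has_integral mu (fun x => (v x ^+ 2 * ln (v x ^+ 2))%:E) /\
  (\int[mu]_x (v x ^+ 2 * ln (v x ^+ 2))%:E <= (2 / q * ln A)%:E)%E.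
Proof.
move=> A0 v1 vA.
have i2 : mu.-integrable setT (fun x => (v x ^+ 2)%:E).
  apply/integrableP; split => //.
  under eq_integral do rewrite gee0_abs ?lee_fin ?sqr_ge0//.
  by rewrite v1 ltry.
have ip : mu.-integrable setT (fun x => (`|v x| `^ (2 + q))%:E).
  apply/integrableP; split => //.
  under eq_integral do rewrite gee0_abs ?lee_fin ?powR_ge0//.
  by rewrite (le_lt_trans vA)// ltry.
have [ig intg] := integrable_sqr_ln_bound A i2 ip.
have [|? le] := has_integral_le_integrable measurable_sqr_ln_sqr ig.
  by move=> x; rewrite lee_fin sqr_ln_sqr_le.
split => //; apply: le_trans le _; rewrite intg v1 mule1.
have qA0 : 0 <= 2 / (q * A) by rewrite divr_ge0// mulr_ge0// ltW.
apply: le_trans (leeD2r _ (lee_wpmul2l _ vA)) _; first by rewrite lee_fin.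
rewrite -EFinM -EFinD lee_fin le_eqVlt; apply/orP; left; apply/eqP; field.
by rewrite !gt_eqF.
Qed.

End entropy.

(** * A Sobolev-type bound for power energies *)

Section power_energy.
Context (R : realType) (n : nat) (F : R -> R) (u : euclidean_space R n -> R).
Variables (a b : R).
Hypotheses (n_gt0 : (0 < n)%N) (a_gt0 : 0 < a) (b_gt0 : 0 < b).
Hypothesis F_ge0 : forall s, 0 <= s -> 0 <= F s.
Hypothesis F_nd : forall s t, 0 <= s -> s <= t -> F s <= F t.
Hypothesis FE : forall s, 0 <= s -> F s = a * s `^ b.
Hypothesis meas_u : measurable_fun setT u.

Local Notation mu := (lebesgue_measure_euclidean R n).
Local Notation q := (4 / n%:R : R).

Let q_gt0 : 0 < q. Proof. by rewrite divr_gt0// ltr0n. Qed.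

Lemma measurable_power_norm : measurable_fun setT (fun s : R => F `|s|).
Proof.
under eq_fun do rewrite FE//.
apply: measurable_funM => //.
by apply: (measurableT_comp (measurable_powR b)).
Qed.

Lemma nonlocal_energy_lt2 :
  b < 2 -> (nonlocal_energy F u < +oo)%E -> nonlocal_energy F u = 0%E.
Proof.
move=> b2; have [|K K02 Kb] := @powRD_le R b; first by rewrite b_gt0.
apply: (nonlocal_energy_eq0 _ _ _ K02) => //; first exact: measurable_power_norm.
move=> s t s0 t0; rewrite !FE ?addr_ge0// -mulrDr mulrCA ler_pM2l//.
exact: Kb.
Qed.

Definition sobolev_constant : R := level_constant R n * 2 `^ (b + q) / a.

Lemma sobolev_constant_gt0 : 0 < sobolev_constant.
Proof.
apply: divr_gt0 => //; apply: mulr_gt0; first exact: level_constant_gt0.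
exact: powR_gt0.
Qed.

Variable M : R.
Hypothesis M_gt0 : 0 < M.
Hypothesis u_le : (\int[mu]_x (u x ^+ 2)%:E <= (M ^+ 2)%:E)%E.
Hypothesis E_fin : (nonlocal_energy F u < +oo)%E.

Let measurable_abs_powR p : measurable_fun setT (fun x => (`|u x| `^ p)%:E).
Proof.
apply/measurable_EFinP; apply: (measurableT_comp (measurable_powR p)).
exact: measurableT_comp.
Qed.

Lemma integral_powR_le_energy :
  (\int[mu]_x (`|u x| `^ (b + q))%:E <=
   (sobolev_constant * M `^ q * fine (nonlocal_energy F u))%:E)%E.
Proof.
have := integral_level_le_energy n_gt0 F_ge0 F_nd measurable_power_norm meas_u
  (exprn_gt0 2 M_gt0) u_le.
have bq : b + q != 0 by rewrite gt_eqF// addr_gt0.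
have two_gt0 : 0 < 2 `^ (b + q) :> R by exact: powR_gt0.
have FhE x : F (`|u x| / 2) * (`|u x| / 2) `^ q =
    a / 2 `^ (b + q) * `|u x| `^ (b + q).
  rewrite FE ?divr_ge0// -mulrA -powRD ?(negbTE bq)//.
  by rewrite powRM// -(powR_inv1 (ler0n R 2)) -powRrM mulN1r powRN mulrA mulrAC.
under eq_integral do rewrite FhE EFinM.
rewrite ge0_integralZl//; last first.
  by rewrite lee_fin divr_ge0// ltW.
have c0 : 0 < a / 2 `^ (b + q) by rewrite divr_gt0.
rewrite muleC -lee_pdivlMr// => /le_trans; apply.
have EF : nonlocal_energy F u = (fine (nonlocal_energy F u))%:E.
  rewrite fineK// ge0_fin_numE// nonlocal_energy_ge0//.
rewrite {1}EF -!EFinM lee_fin le_eqVlt; apply/orP; left; apply/eqP.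
have -> : (M ^+ 2) `^ (2 / n%:R) = M `^ q.
  rewrite -powR_mulrn ?(ltW M_gt0)// -powRrM; congr (_ `^ _).
  by field; rewrite pnatr_eq0 -lt0n.
by rewrite /sobolev_constant; field; rewrite !gt_eqF.
Qed.

Lemma integral_powR_le_sobolev :
  (\int[mu]_x (`|u x| `^ (2 + q))%:E <=
   (M `^ (2 + q) *
    (1 + sobolev_constant * fine (nonlocal_energy F u) / M `^ b))%:E)%E.
Proof.
have E0 : 0 <= fine (nonlocal_energy F u).
  by apply: fine_ge0; exact: nonlocal_energy_ge0.
have K0 := sobolev_constant_gt0.
have [b2|b2] := ltP b 2.
  apply: (@le_trans _ _ 0%E); last first.
    by rewrite lee_fin mulr_ge0 ?powR_ge0// addr_ge0// divr_ge0 ?powR_ge0//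
      mulr_ge0// (ltW K0).
  have := integral_powR_le_energy; rewrite nonlocal_energy_lt2//= mulr0 => I0.
  have {}I0 : (\int[mu]_x `|(`|u x| `^ (b + q))%:E| = 0)%E.
    apply/eqP; rewrite eq_le; apply/andP; split; last exact: integral_ge0.
    by under eq_integral do rewrite gee0_abs ?lee_fin ?powR_ge0//.
  have /(ae_eq_integral_abs _ measurableT (measurable_abs_powR _)) u0 := I0.
  rewrite (ae_eq_integral (cst 0%E)) ?integral0//.
  apply: filterS u0 => x /= ux _; case: (ux I) => /powR_eq0_eq0 ->.
  by rewrite powR0// gt_eqF// addr_gt0.
(* For [b >= 2] the first term dominates where [|u| <= M], and the second where [|u| > M], since
   there [|u|]^ (b - 2) >= M [^ (b - 2)]. *)
apply: (@le_trans _ _ (\int[mu]_x ((M `^ q)%:E * (u x ^+ 2)%:E +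
    (M `^ (2 - b))%:E * (`|u x| `^ (b + q))%:E))%E).
  apply: ge0_le_integral => //.
    apply: emeasurable_funD; apply: measurable_funeM => //.
      by apply/measurable_EFinP; exact: measurable_funX.
  move=> x _; rewrite -!EFinM -EFinD lee_fin.
  have [->|ux0] := eqVneq (u x) 0.
    rewrite normr0 powR0; last by rewrite gt_eqF// addr_gt0.
    by rewrite addr_ge0 ?mulr_ge0 ?powR_ge0 ?sqr_ge0.
  rewrite -(real_normK (num_real (u x))) -powR_mulrn//.
  have w0 : 0 < `|u x| by rewrite normr_gt0.
  set w := `|u x| in w0 *.
  rewrite ![w `^ (_ + q)]powRD ?(gt_eqF w0) ?implybT//.
  have [wM|Mw] := leP w M.
    rewrite ler_wpDr ?mulr_ge0 ?powR_ge0// [leRHS]mulrC ler_wpM2l ?powR_ge0//.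
    by apply: ge0_ler_powR => //; rewrite ?nnegrE ltW.
  rewrite ler_wpDl ?mulr_ge0 ?powR_ge0//.
  rewrite mulrA ler_wpM2r ?powR_ge0//.
  rewrite (_ : w `^ b = w `^ 2%:R * w `^ (b - 2)); last first.
    by rewrite -powRD ?(gt_eqF w0) ?implybT// subrKC.
  rewrite -[2 - b]opprB powRN mulrCA ler_peMr ?powR_ge0//.
  rewrite ler_pdivlMl ?powR_gt0// mulr1.
  apply: ge0_ler_powR; rewrite ?nnegrE ?subr_ge0 ?(ltW M_gt0) ?(ltW w0)//.
  exact: ltW.
rewrite ge0_integralD//; last 4 first.
- by move=> x _; rewrite -EFinM lee_fin mulr_ge0 ?powR_ge0 ?sqr_ge0.
- apply: measurable_funeM; apply/measurable_EFinP; exact: measurable_funX.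
- by move=> x _; rewrite -EFinM lee_fin mulr_ge0 ?powR_ge0.
- exact: measurable_funeM.
rewrite !ge0_integralZl_EFin ?powR_ge0//; last 2 first.
- by move=> x _; rewrite lee_fin sqr_ge0.
- apply/measurable_EFinP; exact: measurable_funX.
apply: le_trans (leeD (lee_wpmul2l _ u_le) (lee_wpmul2l _ integral_powR_le_energy)) _.
- by rewrite lee_fin powR_ge0.
- by rewrite lee_fin powR_ge0.
rewrite -!EFinM -EFinD lee_fin le_eqVlt; apply/orP; left; apply/eqP.
rewrite -powR_mulrn ?(ltW M_gt0)// powRB ?(gt_eqF M_gt0) ?implybT//.
rewrite [M `^ (2 + q)]powRD ?(gt_eqF M_gt0) ?implybT//.
by field; rewrite powR_eq0 (gt_eqF M_gt0).
Qed.

End power_energy.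

(** * The norm as the square root of an integral *)

Section L2norm.
Context (R : realType) (n : nat) (u : euclidean_space R n -> R).
Hypothesis uL2 : u \in Lfun (lebesgue_measure_euclidean R n) 2%:E.

Local Notation mu := (lebesgue_measure_euclidean R n).

Lemma measurable_Lfun2 : measurable_fun setT u.
Proof. by have := sub_Lfun_mfun uL2; rewrite inE. Qed.

Lemma integral_sqr_L2norm : (\int[mu]_x (u x ^+ 2)%:E = (L2norm u ^+ 2)%:E)%E.
Proof.
have J0 : (0 <= \int[mu]_x (u x ^+ 2)%:E)%E.
  by apply: integral_ge0 => x _; rewrite lee_fin sqr_ge0.
have Jfin : (\int[mu]_x (u x ^+ 2)%:E)%E \is a fin_num.
  by have := integrable_fin_num measurableT (Lfun2_integrable_sqr uL2).
rewrite /L2norm unlock /=.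
have -> : (\int[mu]_x `|(u x)%:E| `^ 2%R = \int[mu]_x (u x ^+ 2)%:E)%E.
  apply: eq_integral => x _; rewrite poweR_EFin powR_mulrn//.
  by rewrite real_normK// num_real.
rewrite -(fineK Jfin) poweR_EFin /= powR12_sqrt ?fine_ge0// sqr_sqrtr//.
exact: fine_ge0.
Qed.

Lemma L2norm_gt0 : ~ (u = cst 0 %[ae mu]) -> 0 < L2norm u.
Proof.
move=> u0; rewrite lt_neqAle fine_ge0 ?Lnorm_ge0// andbT eq_sym; apply/eqP => M0.
apply: u0; have := integral_sqr_L2norm; rewrite M0 expr0n/= => I0.
have m2 : measurable_fun setT (fun x => (u x ^+ 2)%:E).
  by apply/measurable_EFinP; apply: measurable_funX; exact: measurable_Lfun2.
have {}I0 : (\int[mu]_x `|(u x ^+ 2)%:E| = 0)%E.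
  by rewrite -[RHS]I0; apply: eq_integral => x _; rewrite gee0_abs// lee_fin sqr_ge0.
have /(ae_eq_integral_abs _ measurableT m2) := I0.
apply: filterS => x /(_ I) [] /eqP; rewrite sqrf_eq0 => /eqP ->.
by [].
Qed.

End L2norm.

(** * Normalisation and conclusion *)

Lemma normalized_entropy_le_ln (R : realType) (n : nat)
    (u : euclidean_space R n -> R) (q A : R) :
  u \in Lfun (lebesgue_measure_euclidean R n) 2%:E -> 0 < L2norm u ->
  0 < q -> 0 < A ->
  (\int[lebesgue_measure_euclidean R n]_x (`|u x| `^ (2 + q))%:E <=
   (L2norm u `^ (2 + q) * A)%:E)%E ->
  let h x := (u x ^+ 2 / L2norm u ^+ 2 * ln (u x ^+ 2 / L2norm u ^+ 2))%:E in
  has_integral (lebesgue_measure_euclidean R n) h /\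
  (\int[lebesgue_measure_euclidean R n]_x h x <= (2 / q * ln A)%:E)%E.
Proof.
move=> uL2 M0 q0 A0 uA; set M := L2norm u in M0 uA *.
have meas_u := measurable_Lfun2 uL2.
pose v x := u x / M.
have mv : measurable_fun setT v by exact: measurable_funM.
have -> : (fun x => (u x ^+ 2 / M ^+ 2 * ln (u x ^+ 2 / M ^+ 2))%:E) =
    (fun x => (v x ^+ 2 * ln (v x ^+ 2))%:E).
  by apply/funext => x; rewrite /v expr_div_n.
apply: (entropy_le_ln mv q0 A0).
  have -> : (fun x => (v x ^+ 2)%:E) = (fun x => ((M ^+ 2)^-1)%:E * (u x ^+ 2)%:E)%E.
    by apply/funext => x; rewrite /v expr_div_n -EFinM mulrC.
  rewrite ge0_integralZl_EFin ?invr_ge0 ?sqr_ge0//; last 2 first.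
  - by move=> x _; rewrite lee_fin sqr_ge0.
  - by apply/measurable_EFinP; exact: measurable_funX.
  by rewrite integral_sqr_L2norm// -EFinM mulVf// expf_neq0// gt_eqF.
have -> : (fun x => (`|v x| `^ (2 + q))%:E) =
    (fun x => ((M `^ (2 + q))^-1)%:E * (`|u x| `^ (2 + q))%:E)%E.
  apply/funext => x; rewrite /v normrM [ `|M^-1|]ger0_norm ?invr_ge0 ?(ltW M0)//.
  rewrite powRM ?invr_ge0 ?(ltW M0)// -(powR_inv1 (ltW M0)) -powRrM mulN1r powRN.
  by rewrite -EFinM mulrC.
rewrite ge0_integralZl_EFin ?invr_ge0 ?powR_ge0//; last first.
  apply/measurable_EFinP; apply: (measurableT_comp (measurable_powR (2 + q))).
  exact: measurableT_comp.
rewrite muleC lee_pdivrMr ?powR_gt0//.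
by rewrite -EFinM mulrC.
Qed.

Theorem theorem1p4 (R : realType) (N : nat) (F : R -> R) :
  (3 <= N)%N ->
  (forall s, 0 <= s -> 0 <= F s) ->
  (forall s t, 0 <= s -> s <= t -> F s <= F t) ->
  (exists2 s, 0 <= s & F s != 0) ->
  exists2 C : R, 0 < C &
    forall beta : R, 0 < beta ->
    (forall s t, 0 <= s -> 0 <= t -> F (t * s) <= t `^ beta * F s) ->
    (forall u : euclidean_space R N -> R,
      u \in Lfun (lebesgue_measure_euclidean R N) 2%:E ->
      ~ (u = cst 0 %[ae lebesgue_measure_euclidean R N]) ->
      (nonlocal_energy F u < +oo)%E ->
      let h := fun x => (u x ^+ 2 / L2norm u ^+ 2 *
                         ln (u x ^+ 2 / L2norm u ^+ 2))%:E in
      has_integral (lebesgue_measure_euclidean R N) h /\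
      (\int[lebesgue_measure_euclidean R N]_x h x +
         (N%:R / 2 * ln (L2norm u `^ beta))%:E <=
       (N%:R / 2 * ln (C * L2norm u `^ beta +
                       C * fine (nonlocal_energy F u)))%:E)%E) /\
    (forall u : euclidean_space R N -> R,
      u \in Lfun (lebesgue_measure_euclidean R N) 2%:E ->
      (nonlocal_energy F u < +oo)%E ->
      let h := fun x => (u x ^+ 2 * ln (u x ^+ 2))%:E in
      has_integral (lebesgue_measure_euclidean R N) h /\
      (\int[lebesgue_measure_euclidean R N]_x h x < +oo)%E).
Proof.
move=> N3 F_ge0 F_nd F_neq0.
have N0 : (0 < N)%N by exact: leq_trans N3.
have NR0 : 0 < N%:R :> R by rewrite ltr0n.
have q0 : 0 < 4 / N%:R :> R by rewrite divr_gt0.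
pose degree b := 0 < b /\
  (forall s t, 0 <= s -> 0 <= t -> F (t * s) <= t `^ b * F s).
(* The constant has to be chosen before the exponent is given. If no exponent is admissible, the
   claim is vacuous and 1 will do. *)
have [[b [b0 Fb]]|no_degree] := pselect (exists b, degree b); last first.
  by exists 1 => // b b0 Fb; exfalso; apply: no_degree; exists b.
have a0 := homogeneous_gt0 F_ge0 F_neq0 b0 Fb.
have FE := homogeneous_eq_powR F_ge0 b0 Fb.
pose K := sobolev_constant N (F 1) b.
have K0 : 0 < K by exact: sobolev_constant_gt0.
exists (1 + K); first by rewrite addr_gt0.
move=> c c0 Fc; rewrite (homogeneous_degree_unique F_ge0 F_neq0 c0 b0 Fc Fb).
have mF := measurable_power_norm FE.
split=> u uL2.
  move=> /(L2norm_gt0 uL2) M0 Eoo h; set M := L2norm u in h M0 *.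
  have meas_u := measurable_Lfun2 uL2.
  have E0 : 0 <= fine (nonlocal_energy F u).
    by apply: fine_ge0; exact: nonlocal_energy_ge0.
  set E := fine _ in E0 *.
  have Mb0 : 0 < M `^ b by exact: powR_gt0.
  have A0 : 0 < 1 + K * E / M `^ b.
    apply: ltr_pwDl => //; apply: divr_ge0; last exact: ltW.
    by apply: mulr_ge0 => //; exact: ltW.
  have [|hi hle] := normalized_entropy_le_ln uL2 M0 q0 A0.
    apply: integral_powR_le_sobolev => //.
    by rewrite integral_sqr_L2norm.
  split=> //; apply: le_trans (leeD2r _ hle) _.
  rewrite -EFinD lee_fin invf_div mulrA.
  have -> : 2 * N%:R / 4 = N%:R / 2 :> R by field.
  rewrite -mulrDr ler_pM2l ?divr_gt0// -lnM ?posrE//.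
  have K1 : 0 < 1 + K by rewrite addr_gt0.
  have B0 : 0 < (1 + K) * M `^ b + (1 + K) * E.
    by apply: ltr_pwDl; [exact: mulr_gt0|apply: mulr_ge0 => //; exact: ltW].
  rewrite ler_ln ?posrE ?mulr_gt0//.
  rewrite mulrDl mul1r divfK ?gt_eqF//.
  by rewrite [(1 + K) * _]mulrDl [(1 + K) * E]mulrDl !mul1r; nra.
move=> Eoo h.
have meas_u := measurable_Lfun2 uL2.
have i2 := Lfun2_integrable_sqr uL2.
apply: (entropy_lt_pinfty meas_u q0) => //.
apply/integrableP; split.
  apply/measurable_EFinP; apply: (measurableT_comp (measurable_powR _)).
  exact: measurableT_comp.
under eq_integral do rewrite gee0_abs ?lee_fin ?powR_ge0//.
(* Here [u] may vanish almost everywhere, so its norm is replaced by a larger, positive number. *)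
pose M := L2norm u + 1.
have M0 : 0 < M by rewrite ltr_wpDl// fine_ge0// Lnorm_ge0.
apply: le_lt_trans (integral_powR_le_sobolev N0 a0 b0 F_ge0 F_nd FE meas_u M0 _ Eoo) _.
  rewrite integral_sqr_L2norm// lee_fin lerXn2r ?nnegrE ?(ltW M0)//.
    by rewrite fine_ge0// Lnorm_ge0.
  by rewrite lerDl.
exact: ltry.
Qed.
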